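(* Let $(S,+,\cdot,0,1)$ be a positive semifield. Then for every set $X$ and every $\Phi\in\mathcal S\mathcal P X$, \[ \delta_X(\Phi)=\Bigl\{\mu^{\mathcal S}_X(\Psi)\ \Bigm|\ \Psi\in\mathcal S\mathcal S X,\ \sum_{\phi\in\mathcal S X}\Psi(\phi)=1,\ \mathrm{supp}\,\Psi\subseteq c(\Phi)\Bigr\}, \] i.e. $\delta_X(\Phi)$ is the convex closure of $c(\Phi)$ in the $\mathcal S$-algebra $(\mathcal S X,\mu^{\mathcal S}_X)$.
   Context: A semiring $(S,+,\cdot,0,1)$ is positive if $a+b=0$ implies $a=b=0$; it is a semifield if every $a\neq 0$ has some $x$ with $a\cdot x=x\cdot a=1$. For a set $X$, $\mathcal S X$ is the set of functions $\phi\colon X\to S$ with finite support $\mathrm{supp}\,\phi=\{x\mid\phi(x)\neq 0\}$; for $f\colon X\to Y$, $\mathcal S(f)(\phi)(y)=\sum_{x\in f^{-1}\{y\}}\phi(x)$; and $\mu^{\mathcal S}_X\colon\mathcal S\mathcal S X\to\mathcal S X$ is $\mu^{\mathcal S}_X(\Psi)(x)=\sum_{\phi\in\mathrm{supp}\,\Psi}\Psi(\phi)\cdot\phi(x)$. $\mathcal P X$ is the powerset of $X$. Write $\ni_X=\{(A,x)\in\mathcal P X\times X\mid x\in A\}$. For $\Phi\in\mathcal S\mathcal P X$, $\delta_X(\Phi)=\{\phi\in\mathcal S X\mid \exists\psi\in\mathcal S(\ni_X).\ \forall A\in\mathcal P X.\ \Phi(A)=\sum_{x\in A}\psi(A,x)\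 \text{and}\ \forall x\in X.\ \phi(x)=\sum_{A\ni x}\psi(A,x)\}$, and $c(\Phi)$ is the set of all functions $\chi_u\in\mathcal S X$, $\chi_u(x)=\sum_{A\in\mathrm{supp}\,\Phi,\ u(A)=x}\Phi(A)$, where $u$ ranges over functions $u\colon\mathrm{supp}\,\Phi\to X$ with $u(A)\in A$ for all $A\in\mathrm{supp}\,\Phi$. *)

(* Defs.v *)
From mathcomp Require Import all_boot all_algebra finmap.
From mathcomp Require Import boolp classical_sets fsbigop.

Set Implicit Arguments.
Unset Strict Implicit.
Unset Printing Implicit Defensive.

Import GRing.Theory.

Local Open Scope classical_set_scope.
Local Open Scope ring_scope.

(* [pzSemiRingType]: multiplication need not commute and 1 = 0 is allowed. *)
Definition positive_semiring (S : pzSemiRingType) : Prop :=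
  forall a b : S, a + b = 0 -> a = 0 /\ b = 0.

Definition semifield (S : pzSemiRingType) : Prop :=
  forall a : S, a <> 0 -> exists x : S, a * x = 1 /\ x * a = 1.

(* The set of finitely supported functions X -> S; supp is [finsupp]. *)
Notation SF S X := {fsfun X -> S with 0}.

(* In [mu] and [chi] the explicit finite set only witnesses finite support: the
   sum vanishes outside it, so it is the value at every point ([muE], [chiE]). *)
Definition mu (S : pzSemiRingType) (X : choiceType) (Psi : SF S (SF S X)) :
    SF S X :=
  [fsfun x in (\bigcup_(phi <- finsupp Psi) finsupp phi)%fset =>
     \sum_(phi <- finsupp Psi) Psi phi * phi x | 0].

Lemma muE (S : pzSemiRingType) (X : choiceType) (Psi : SF S (SF S X)) (x : X) :
  mu Psi x = \sum_(phi <- finsupp Psi) Psi phi * phi x.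
Proof.
rewrite /mu fsfunE; case: ifPn => // xN.
rewrite big_seq big1 // => phi phiP.
rewrite (@fsfun_dflt _ _ _ phi) ?mulr0 //.
apply: contra xN => xphi; apply/bigfcupP.
by exists phi; rewrite ?phiP.
Qed.

Definition ni (X : choiceType) : set (set X * X) := [set p | p.1 p.2].
Arguments ni X : clear implicits.

(* [\sum_(p \in D) psi p] is the sum over D `&` supp psi, which is finite. *)
Definition delta (S : pzSemiRingType) (X : choiceType) (Phi : SF S (set X)) :
    set (SF S X) :=
  [set phi : SF S X | exists psi : SF S (ni X),
     (forall A : set X,
        Phi A = \sum_(p \in [set p : ni X | (val p).1 = A]) psi p) /\
     (forall x : X,
        phi x = \sum_(p \in [set p : ni X | (val p).2 = x]) psi p)].

Definition chi (S : pzSemiRingType) (X : choiceType) (Phi : SF S (set X))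
    (u : finsupp Phi -> X) : SF S X :=
  [fsfun x in [fset u A | A : finsupp Phi]%fset =>
     \sum_(A : finsupp Phi | u A == x) Phi (val A) | 0].

Lemma chiE (S : pzSemiRingType) (X : choiceType) (Phi : SF S (set X))
    (u : finsupp Phi -> X) (x : X) :
  chi u x = \sum_(A : finsupp Phi | u A == x) Phi (val A).
Proof.
rewrite /chi fsfunE; case: ifPn => // xN.
rewrite big_pred0 // => A; apply: contraNF xN => /eqP <-.
by apply/imfsetP; exists A.
Qed.

Definition c (S : pzSemiRingType) (X : choiceType) (Phi : SF S (set X)) :
    set (SF S X) :=
  [set chi u | u in
     [set u : finsupp Phi -> X | forall A : finsupp Phi, (val A : set X) (u A)]].

(* Main.v *)
(** A convex combination of the [chi u] is witnessed by the same combination of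
    the couplings [(A, u A) |-> Phi A].  Conversely, a coupling [psi] with
    marginals [Phi] and [phi] yields, for each [A] in the support of [Phi], the
    probability [p_A x = psi (A, x) / Phi A] on [A]; drawing the values [u A]
    independently with law [p_A] gives a distribution on choice functions, and
    the corresponding mixture of the [chi u] is [phi].  Since [S] need not be
    commutative, the product of the [p_A (u A)] is taken in a fixed order of the
    sets [A]; expanding a product of sums only uses distributivity.  Positivity
    ensures that [psi] is supported over the support of [Phi]. *)
Require Import Defs.
From mathcomp Require Import all_boot all_algebra finmap.
From mathcomp Require Import boolp classical_sets fsbigop.

Set Implicit Arguments.
Unset Strict Implicit.

Import GRing.Theory.

Local Open Scope classical_set_scope.
Local Open Scope ring_scope.

Lemma fsbig_fsfun (V : nmodType) (T : choiceType) (D : set T)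
    (f : {fsfun T -> V with 0}) :
  \sum_(t \in D) f t = \sum_(t <- finsupp f | t \in D) f t.
Proof.
rewrite fsbig_mkcond (@fsbigTE _ _ _ _ (finsupp f)); last first.
  by move=> t tf; rewrite /functions.patch; case: ifP => // _; rewrite fsfun_dflt.
by rewrite [RHS]big_mkcond.
Qed.

(** Both the coupling and the mixture are built this way: [g] need not be injective, as weights of
    indices with the same image add up, and sums over the result become sums over the finite type
    [I]. *)
Definition pushforward {S : pzSemiRingType} {I : finType} {T : choiceType}
    (g : I -> T) (w : I -> S) : SF S T :=
  [fsfun t in [fset g i | i : I]%fset => \sum_(i | g i == t) w i | 0].

Lemma pushforwardE (S : pzSemiRingType) (I : finType) (T : choiceType)
    (g : I -> T) (w : I -> S) (t : T) :
  pushforward g w t = \sum_(i | g i == t) w i.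
Proof.
rewrite fsfunE; case: ifPn => // tN.
rewrite big_pred0 // => i; apply: contraNF tN => /eqP <-.
by apply/imfsetP; exists i.
Qed.

Lemma sum_pushforward (S : pzSemiRingType) (I : finType) (T : choiceType)
    (g : I -> T) (w : I -> S) (h : T -> S) :
  \sum_(t <- finsupp (pushforward g w)) pushforward g w t * h t =
  \sum_i w i * h (g i).
Proof.
(* The support may be smaller than the image of [g], since fibre sums can vanish; the added terms
   are 0. *)
rewrite (big_fset_incl _ (finsupp_sub _ _ _)); last first.
  by move=> t _ tN; rewrite fsfun_dflt ?mul0r.
under eq_bigr => t _ do rewrite pushforwardE mulr_suml.
rewrite (exchange_big_dep xpredT) //=; apply: eq_bigr => i _.
rewrite -big_filter (eq_filter (a2 := pred1 (g i))); last first.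
  by move=> t; rewrite /= eq_sym.
rewrite filter_pred1_uniq ?fset_uniq ?big_seq1 //.
by apply/imfsetP; exists i.
Qed.

Lemma fsbig_pushforward (S : pzSemiRingType) (I : finType) (T : choiceType)
    (g : I -> T) (w : I -> S) (D : set T) :
  \sum_(t \in D) pushforward g w t = \sum_(i | g i \in D) w i.
Proof.
(* The condition [t \in D] becomes a 0-1 factor on the right, so that [sum_pushforward] applies. *)
have E : forall (b : bool) (x : S), x * b%:R = if b then x else 0.
  by case=> x; rewrite ?mulr1 ?mulr0.
rewrite fsbig_fsfun [LHS]big_mkcond [RHS]big_mkcond /=.
under eq_bigr do rewrite -E.
rewrite (sum_pushforward g w (fun t => (t \in D)%:R)).
by apply: eq_bigr => i _; apply: E.
Qed.

Lemma mu_pushforward (S : pzSemiRingType) (I : finType) (X : choiceType)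
    (g : I -> SF S X) (w : I -> S) (x : X) :
  mu (pushforward g w) x = \sum_i w i * g i x.
Proof. by rewrite muE (sum_pushforward g w (fun phi => phi x)). Qed.

(** Marginal at [a] of a product distribution: by distributivity the sum is an ordered product of
    row sums, where every row but [a] contributes 1. *)
Lemma sum_family_prod (S : pzSemiRingType) (I J : finType) (f : I -> J -> S)
    (a : I) (P : pred J) :
  (forall i, \sum_j f i j = 1) ->
  \sum_(u : {ffun I -> J} | P (u a)) \prod_i f i (u i) = \sum_(j | P j) f a j.
Proof.
move=> f1; pose Q i : pred J := fun j => (i == a) ==> P j.
transitivity (\sum_(u in family Q) \prod_i f i (u i)).
  apply: eq_bigl => u; apply/idP/familyP => [Pa i | /(_ a)].
    by rewrite unfold_in; apply/implyP => /eqP ->.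
  by rewrite unfold_in eqxx.
rewrite -bigA_distr_big_dep.
transitivity (\prod_(i | i == a) \sum_(j | P j) f i j); last first.
  by rewrite big_pred1_eq.
by rewrite [RHS]big_mkcond; apply: eq_bigr => i _; rewrite /Q; case: eqP.
Qed.

Lemma prod_neq0 (S : pzSemiRingType) (I : finType) (f : I -> S) (i : I) :
  \prod_j f j != 0 -> f i != 0.
Proof.
apply: contraNneq => fi0; have := mem_index_enum i.
elim: (index_enum I) => // j s IHs; rewrite inE big_cons.
by case: eqP => [<- _|_ /IHs/eqP ->]; rewrite ?fi0 ?mul0r ?mulr0.
Qed.

Lemma positive_sum_eq0 (S : pzSemiRingType) (I : eqType) (r : seq I)
    (P : pred I) (f : I -> S) (i : I) :
  positive_semiring S -> \sum_(j <- r | P j) f j = 0 -> i \in r -> P i -> f i = 0.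
Proof.
move=> Spos; elim: r => // j r IHr; rewrite big_cons inE => s0 ir Pi.
case: eqP ir s0 => [<-|_ /= ir]; first by rewrite Pi => _ /Spos[].
by case: (P j) => [/Spos[_]|] /IHr; apply.
Qed.

Lemma sum_finsupp_pred1 (V : nmodType) (T : choiceType)
    (f : {fsfun T -> V with 0}) (t : T) :
  \sum_(s : finsupp f | val s == t) f (val s) = f t.
Proof.
have -> : f t = \sum_(s \in [set t]) f s by rewrite fsbig_set1.
rewrite fsbig_fsfun big_seq_fsetE; apply: eq_bigl => s.
by apply/eqP/idP; rewrite inE.
Qed.

Lemma delta_mu (S : pzSemiRingType) (X : choiceType) (Phi : SF S (set X))
    (Psi : SF S (SF S X)) :
  \sum_(phi \in [set: SF S X]) Psi phi = 1 -> [set` finsupp Psi] `<=` c Phi ->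
  delta Phi (mu Psi).
Proof.
move=> Psi1 Psic.
have {}Psi1 : \sum_(phi : finsupp Psi) Psi (val phi) = 1.
  rewrite -Psi1 fsbig_fsfun big_seq_fsetE.
  by apply: eq_bigl => phi; rewrite in_setT.
have /choice[u uP] : forall phi : finsupp Psi, exists u : finsupp Phi -> X,
    (forall A, (val A : set X) (u A)) /\ chi u = val phi.
  by move=> phi; have [u uA uphi] := Psic _ (valP phi); exists u.
have niP (i : finsupp Psi * finsupp Phi) :
    (val i.2, u i.1 i.2) \in ni X by apply/mem_set; case: (uP i.1) => uA _; apply: uA.
pose g (i : finsupp Psi * finsupp Phi) : ni X := SigSub (niP i).
exists (pushforward g (fun i => Psi (val i.1) * Phi (val i.2))); split=> [A|x].
- rewrite fsbig_pushforward.
  transitivity (\sum_(phi : finsupp Psi) \sum_(B : finsupp Phi | val B == A)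
      Psi (val phi) * Phi (val B)).
    under eq_bigr do rewrite -mulr_sumr.
    by rewrite -mulr_suml Psi1 mul1r sum_finsupp_pred1.
  rewrite pair_big_dep /=; apply: eq_bigl => i.
  by apply/eqP/idP; rewrite inE.
- rewrite fsbig_pushforward muE big_seq_fsetE /=.
  transitivity (\sum_(phi : finsupp Psi) \sum_(B : finsupp Phi | u phi B == x)
      Psi (val phi) * Phi (val B)).
    apply: eq_bigr => phi _; rewrite -mulr_sumr -chiE.
    by case: (uP phi) => _ ->.
  rewrite pair_big_dep /=; apply: eq_bigl => i.
  by apply/eqP/idP; rewrite inE.
Qed.

Lemma delta_sub_mu (S : pzSemiRingType)
    (Spos : positive_semiring S) (Sfield : semifield S)
    (X : choiceType) (Phi : SF S (set X)) (phi : SF S X) :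
  delta Phi phi ->
  exists2 Psi : SF S (SF S X),
    \sum_(phi \in [set: SF S X]) Psi phi = 1 /\ [set` finsupp Psi] `<=` c Phi
    & mu Psi = phi.
Proof.
case=> psi [psi1 psi2].
have {}psi1 A :
    Phi A = \sum_(p : finsupp psi | (val (val p)).1 == A) psi (val p).
  rewrite psi1 fsbig_fsfun big_seq_fsetE; apply: eq_bigl => p.
  by apply/idP/eqP; rewrite inE.
have {}psi2 x :
    phi x = \sum_(p : finsupp psi | (val (val p)).2 == x) psi (val p).
  rewrite psi2 fsbig_fsfun big_seq_fsetE; apply: eq_bigl => p.
  by apply/idP/eqP; rewrite inE.
have Phi_neq0 (p : finsupp psi) : (val (val p)).1 \in finsupp Phi.
  rewrite mem_finsupp; apply: contraTneq (valP p) => /[!psi1] Phi0.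
  rewrite mem_finsupp negbK.
  exact/eqP/(positive_sum_eq0 Spos Phi0 (mem_index_enum p) (eqxx _)).
have /choice[v vP] (A : finsupp Phi) :
    exists v, Phi (val A) * v = 1 /\ v * Phi (val A) = 1.
  by apply: Sfield; apply/eqP; rewrite -mem_finsupp; apply: valP.
(* The choice at [A] is drawn among the pairs in [finsupp psi], a finite type,
   rather than among the points of [X]; pairs not over [A] get weight 0. *)
pose f (A : finsupp Phi) (p : finsupp psi) : S :=
  if (val (val p)).1 == val A then psi (val p) * v A else 0.
have f1 A : \sum_p f A p = 1.
  rewrite -big_mkcond -mulr_suml -psi1.
  by case: (vP A).
(* [g u] may lie outside [c Phi] when some [u A] is not over [A]; such [u] have weight [w u] equal
   to 0. *)
pose g (u : {ffun finsupp Phi -> finsupp psi}) := chi (fun A => (val (val (u A))).2).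
pose w (u : {ffun finsupp Phi -> finsupp psi}) := \prod_A f A (u A).
exists (pushforward g w).
  split.
    rewrite fsbig_pushforward.
    under eq_bigl do rewrite in_setT.
    rewrite /w -bigA_distr_bigA big1 //.
  move=> chiu /=; rewrite mem_finsupp pushforwardE => w_neq0.
  have [u /eqP <- wu] : exists2 u, g u == chiu & w u != 0.
    apply: contrapT => noU; case/eqP: w_neq0; rewrite big1 // => u gu.
    by apply: contrapT => /eqP wu; apply: noU; exists u.
  exists (fun A => (val (val (u A))).2) => //= A.
  (* A nonzero factor rules out the default branch of [f], so [u A] is a pair over [A] and its point
     belongs to [A]. *)
  have := prod_neq0 A wu; rewrite /f.
  case: ifP => [/eqP <- _|_ /negP[//]].
  by have := valP (val (u A)); rewrite inE.
apply/fsfunP => x; rewrite mu_pushforward psi2.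
under eq_bigr => u _ do rewrite chiE mulr_sumr.
rewrite (exchange_big_dep xpredT) //=.
transitivity (\sum_(A : finsupp Phi)
    \sum_(p : finsupp psi | ((val (val p)).2 == x) && ((val (val p)).1 == val A))
       psi (val p)).
  apply: eq_bigr => A _; rewrite -mulr_suml.
  rewrite (sum_family_prod A (fun p => (val (val p)).2 == x) f1).
  (* [Phi A] stands to the right of the weight, so it cancels by [v A * Phi A = 1]; the
     normalisation [f1] used the other inverse law. *)
  rewrite -big_mkcondr -mulr_suml -mulrA; case: (vP A) => _ ->.
  by rewrite mulr1.
rewrite (exchange_big_dep (fun p => (val (val p)).2 == x)) //=; last first.
  by move=> A p _ /andP[].
apply: eq_bigr => p px.
(* Each [p] lies over exactly one set of the support of [Phi], so [psi p] is counted once. *)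
rewrite (big_pred1 [` Phi_neq0 p]%fset) // => A.
by rewrite px /= eq_sym -val_eqE.
Qed.

Theorem theorem3p5 (S : pzSemiRingType)
    (Spos : positive_semiring S) (Sfield : semifield S)
    (X : choiceType) (Phi : SF S (set X)) :
  delta Phi =
  [set mu Psi | Psi in
     [set Psi : SF S (SF S X) |
        \sum_(phi \in [set: SF S X]) Psi phi = 1 /\
        [set` finsupp Psi] `<=` c Phi]].
Proof.
apply/seteqP; split=> [phi /(delta_sub_mu Spos Sfield)//|_ [Psi [Psi1 Psic] <-]].
exact: delta_mu.
Qed.
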